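(* Let $\mathcal H$ have dimension $d\ge2$ and let $\mathcal L_{\rm depol}(X)=\mathrm{Tr}(X/d)\,\mathbf 1-X$ be the generator of the depolarizing semigroup. Then for every $p\in(1,2]$ its optimal $p$-Beckner constant is $$\alpha_p(\mathcal L_{\rm depol})=\inf\ \frac p4\cdot\frac{\big(\theta x^p+(1-\theta)y^p\big)-\big(\theta x^{p-1}+(1-\theta)y^{p-1}\big)}{\big(\theta x^p+(1-\theta)y^p\big)-1},$$ where the infimum is over all $\theta\in\{\frac1d,\frac2d,\dots,1-\frac1d\}$ and all $x,y\ge0$ with $\theta x+(1-\theta)y=1$ and $(x,y)\ne(1,1)$.
   Context: $\mathcal L_{\rm depol}$ generates the semigroup $\mathcal P_t(X)=e^{-t}X+(1-e^{-t})\frac{\mathrm{Tr}(X)}{d}\mathbf 1$ on $\mathcal B(\mathcal H)$, with unique invariant state $\mathbf 1/d$. For $X\ge0$ and $p>0$ put $\|X\|_{p,\mathbf 1/d}=\big(\tfrac1d\mathrm{Tr}(X^p)\big)^{1/p}$, and for $p>1$, with $\hat p=p/(p-1)$, $$\mathcal E_{p,\mathcal L_{\rm depol}}(X)=-\frac{\hat p\,p}{4}\cdot\frac1d\,\mathrm{Tr}\big(X^{p-1}\mathcal L_{\rm depol}(X)\big).$$ The optimal $p$-Beckner constant $\alpha_p(\mathcal L_{\rm depol})$ is the largest constant $\alpha_p$ such that $$\alpha_p\,\hat p\,\big(\|X\|_{p,\mathbf 1/d}^p-\|X\|_{1,\mathbf 1/d}^p\big)\le\mathcal E_{p,\mathcal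 L_{\rm depol}}(X)\qquad\text{for all }X>0.$$ *)

(* Defs.v *)
From HB Require Import structures.
From mathcomp Require Import all_boot all_order all_algebra.
From mathcomp Require Import complex.
From mathcomp Require Import all_classical all_reals all_analysis.
From mathcomp Require Import ring lra.

Set Implicit Arguments.
Unset Strict Implicit.
Unset Printing Implicit Defensive.

Import Order.TTheory GRing.Theory Num.Theory.
Local Open Scope classical_set_scope.
Local Open Scope complex_scope.
Local Open Scope sesquilinear_scope.
Local Open Scope ring_scope.

Definition posdefmx (R : realType) (d : nat) (X : 'M[R[i]]_d) : Prop :=
  X \is hermsymmx /\
  forall v : 'rV[R[i]]_d, v != 0 -> 0 < (v *m X *m v ^t*) 0 0.

(* Functional calculus: if X = U^-1 diag(l) U is the spectral decomposition,
   then X^s = U^-1 diag(l^s) U.  This is meaningful only for positive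
   semidefinite X, whose eigenvalues l are real and nonnegative; [powR] is
   applied to their real parts. *)
Definition mxpow (R : realType) (d : nat) (X : 'M[R[i]]_d) (s : R) :
    'M[R[i]]_d :=
  invmx (spectralmx X) *m
  diag_mx (map_mx (fun l : R[i] => (powR (complex.Re l) s)%:C)
                  (spectral_diag X)) *m
  spectralmx X.

(* The real part of (1/d) Tr(X).  All traces taken below are those of X^p or
   of X^(p-1) L(X), which are real when X is positive and L is the generator
   of the depolarizing semigroup. *)
Definition ntrace (R : realType) (d : nat) (X : 'M[R[i]]_d) : R :=
  complex.Re (\tr X) / d%:R.

Definition mxpnorm (R : realType) (d : nat) (p : R) (X : 'M[R[i]]_d) : R :=
  powR (ntrace (mxpow X p)) p^-1.

Definition hconj (R : realType) (p : R) : R := p / (p - 1).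

Definition depol (R : realType) (d : nat) (X : 'M[R[i]]_d) : 'M[R[i]]_d :=
  (\tr (d%:R^-1 *: X))%:M - X.

Definition pdirichlet (R : realType) (d : nat)
    (L : 'M[R[i]]_d -> 'M[R[i]]_d) (p : R) (X : 'M[R[i]]_d) : R :=
  - (hconj p * p / 4) * ntrace (mxpow X (p - 1) *m L X).

Definition beckner_ineq (R : realType) (d : nat)
    (L : 'M[R[i]]_d -> 'M[R[i]]_d) (p a : R) : Prop :=
  forall X : 'M[R[i]]_d, posdefmx X ->
    a * hconj p * (powR (mxpnorm p X) p - powR (mxpnorm 1 X) p)
      <= pdirichlet L p X.

Definition optimal_beckner (R : realType) (d : nat)
    (L : 'M[R[i]]_d -> 'M[R[i]]_d) (p a : R) : Prop :=
  beckner_ineq L p a /\ forall b : R, beckner_ineq L p b -> b <= a.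

Definition twopt_ratio (R : realType) (p theta x y : R) : R :=
  p / 4 *
  (((theta * powR x p + (1 - theta) * powR y p)
    - (theta * powR x (p - 1) + (1 - theta) * powR y (p - 1)))
   / ((theta * powR x p + (1 - theta) * powR y p) - 1)).

Definition twopt_values (R : realType) (d : nat) (p : R) : set R :=
  [set r | exists (k : nat) (x y : R), let theta := k%:R / d%:R in
    [/\ (0 < k < d)%N, 0 <= x /\ 0 <= y,
        theta * x + (1 - theta) * y = 1, (x, y) <> (1, 1)
      & r = twopt_ratio p theta x y]].

Section has_inf.
Context (R : realType).
Implicit Types p x y t : R.

Lemma powR_sub_ge p x : 1 < p -> 0 <= x -> x - 1 <= powR x p - powR x (p - 1).
Proof.
move=> p1 x0; have [->|xn0] := eqVneq x 0.
  by rewrite !powR0; lra.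
have -> : powR x p = powR x (p - 1) * x.
  rewrite -{3}(powRr1 x0) -powRD ?subrK//.
  by apply/implyP.
have [x1|x1] := leP 1 x.
  have h : 1 <= powR x (p - 1).
    have e1 : powR 1 (p - 1) = 1 :> R by rewrite powR1.
    rewrite -[leLHS]e1.
    by apply: ge0_ler_powR; rewrite ?nnegrE; lra.
  nra.
have h : powR x (p - 1) <= 1.
  have e1 : powR 1 (p - 1) = 1 :> R by rewrite powR1.
  rewrite -[leRHS]e1.
  by apply: ge0_ler_powR; rewrite ?nnegrE; lra.
nra.
Qed.

Lemma powR_tangent p x : 1 < p -> 0 <= x -> 1 + p * (x - 1) <= powR x p.
Proof.
move=> p1 x0; have [->|xn0] := eqVneq x 0.
  by rewrite powR0; lra.
have xp : 0 < x by rewrite lt_def xn0.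
have q1 : 0 < p / (p - 1) by apply: divr_gt0; lra.
have pe : p^-1 + (p / (p - 1))^-1 = 1 by field; lra.
have := @conjugate_powR _ x 1 p (p / (p - 1)) x0 ler01 ltac:(lra) q1 pe.
rewrite powR1 mulr1 invf_div => h.
have pp : 0 < p by lra.
have : x * p <= (powR x p / p + 1 * ((p - 1) / p)) * p by rewrite ler_pM2r.
have -> : (powR x p / p + 1 * ((p - 1) / p)) * p = powR x p + (p - 1).
  by field; lra.
lra.
Qed.

Lemma has_inf_twopt_values (d : nat) p : (1 < d)%N -> 1 < p ->
  has_inf (twopt_values d p).
Proof.
move=> d1 p1; have d0 : (0 : R) < d%:R by rewrite ltr0n (ltn_trans _ d1).
split.
  have t1 : (1 : R) - 1%:R / d%:R > 0.
    by rewrite subr_gt0 ltr_pdivrMr// mul1r ltr_nat.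
  exists (twopt_ratio p (1%:R / d%:R) 0 (1 - 1%:R / d%:R)^-1).
  exists 1%N, 0, (1 - 1%:R / d%:R)^-1; split => //.
  - by split=> //; rewrite invr_ge0 ltW.
  - by rewrite mulr0 add0r divff// gt_eqF.
  - by case=> /eqP; rewrite eq_sym oner_eq0.
exists 0 => r [k [x [y []]]]; set t := (_ / _) => /andP[k0 kd] [x0 y0] e _ ->.
have t0 : 0 < t by apply: divr_gt0 => //; rewrite ltr0n.
have t1 : t < 1 by rewrite /t ltr_pdivrMr// mul1r ltr_nat.
have hx := powR_sub_ge p1 x0; have hy := powR_sub_ge p1 y0.
have gx := powR_tangent p1 x0; have gy := powR_tangent p1 y0.
apply: mulr_ge0; first lra.
apply: divr_ge0; first nra.
have : t * (1 + p * (x - 1)) + (1 - t) * (1 + p * (y - 1)) <=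
       t * powR x p + (1 - t) * powR y p.
  by apply: lerD; rewrite ler_pM2l// subr_gt0.
have -> : t * (1 + p * (x - 1)) + (1 - t) * (1 + p * (y - 1)) =
          1 + p * (t * x + (1 - t) * y - 1) by ring.
by rewrite e subrr mulr0 addr0 subr_ge0.
Qed.

End has_inf.

(* Main.v *)
Require Import Defs.
From mathcomp Require Import all_boot all_order all_algebra.
From mathcomp Require Import complex.
From mathcomp Require Import all_classical all_reals all_analysis.
From mathcomp Require Import ring lra.

(**
The inequality only sees the eigenvalues of [X].  Writing [mean xs] and
[pmean r xs] for the averages of the eigenvalues and of their [r]-th powers,
the Beckner inequality for the depolarizing generator is the scalar inequality
   a * (pmean p xs - (mean xs)^p)
     <= p/4 * (pmean p xs - mean xs * pmean (p-1) xs),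
to be satisfied by all lists [xs] of [d] positive numbers
([beckner_ineq_depolE]).  Every such list is the spectrum of a diagonal matrix,
so nothing is lost.

Upper bound on the constant ([scalar_beckner_le_twopt]).  Lists with two
distinct values, repeated [n] and [d - n] times, turn the scalar inequality
into [a <= twopt_ratio]; the points with a zero coordinate are limits of
positive ones along the segment towards (1, 1).

Lower bound ([scalar_beckner_of_twopt]).  By homogeneity take mean 1.  The
inequality then reads [0 <= \sum gap (p/4 - a) x] for the function
   gap k x = k x^p - (p/4) x^(p-1) + (p/4 - k),
which vanishes at 1, and the two-point inequalities say that this sum is
nonnegative on lists with two values.  The second derivative of [gap k] has the
sign of the affine function [k x + (2-p)/4].
- If [k >= 0], then [gap k] is convex and the tangent line at 1 concludes.
- If [k < 0], then [gap k] is convex up to some [s] and concave beyond.  Two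
  entries above [s] can be spread apart, one of them going down to [s], which
  by concavity does not increase the sum.  When a single entry is left above
  [s], Jensen's inequality replaces all the others by their average.  The
  result has at most two values, with multiplicities [1] and [d - 1]
  ([two_value_le]), so the hypothesis applies.
For [p = 2] the inflection point [s] would be 0, but then every two-point ratio
is 1/2 and [k >= 0].
*)

Set Implicit Arguments.
Unset Strict Implicit.
Unset Printing Implicit Defensive.

Import Order.TTheory GRing.Theory Num.Theory.
Import numFieldNormedType.Exports.
Local Open Scope classical_set_scope.
Local Open Scope complex_scope.
Local Open Scope sesquilinear_scope.
Local Open Scope ring_scope.

(** * Sums of a function that is convex, then concave *)

Lemma sum_itv (R : realType) (s : R) (xs : seq R) : xs != [::] ->
  all (fun x => 0 < x <= s) xs ->
  0 < \sum_(x <- xs) x <= (size xs)%:R * s.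
Proof.
elim: xs => [//|x [|y xs] IH] _ /=.
  by rewrite !andbT big_cons big_nil mul1r addr0.
move=> /andP[/andP[x0 xs0]] /(IH isT)/= /andP[h1 h2].
by rewrite big_cons -natr1; apply/andP; split; lra.
Qed.

Section HalfConvex.
Context (R : realType) (f f' : R -> R).
Hypothesis fE : forall x : R, 0 < x -> is_derive x 1 f (f' x).

Lemma mvt_pos x y : 0 < x -> x <= y ->
  exists2 c, x <= c <= y & f y - f x = f' c * (y - x).
Proof.
move=> x0 xy; have [||c] := @MVT_segment R f f' x y xy.
- by move=> z; rewrite in_itv/= => /andP[xz _]; apply/fE/(lt_trans x0).
- apply: derivable_within_continuous => z; rewrite in_itv/= => /andP[xz _].
  by have [] := fE (lt_le_trans x0 xz).
- by rewrite in_itv/=; exists c.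
Qed.

(** The derivative is only assumed monotone below [s], so that the lemma serves
    both a function convex everywhere ([s] large) and one convex up to its
    inflection point. *)
Lemma tangent_le s x y :
  (forall u v, 0 < u -> u <= v -> v <= s -> f' u <= f' v) ->
  0 < x <= s -> 0 < y <= s -> f x + f' x * (y - x) <= f y.
Proof.
move=> f'_homo /andP[x0 xs] /andP[y0 ys]; have [xy|/ltW yx] := leP x y.
  have [c /andP[xc cy] fxy] := mvt_pos x0 xy.
  have : f' x * (y - x) <= f' c * (y - x).
    by rewrite ler_wpM2r ?subr_ge0// f'_homo// (le_trans cy).
  by lra.
have [c /andP[yc cx] fyx] := mvt_pos y0 yx.
have : f' c * (x - y) <= f' x * (x - y).
  by rewrite ler_wpM2r ?subr_ge0// f'_homo// (lt_le_trans y0).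
by lra.
Qed.

(** Summed tangent lines at [m].  The correction term vanishes when [m] is the
    average of [xs], which gives Jensen's inequality. *)
Lemma sum_tangent s m (xs : seq R) :
  (forall u v, 0 < u -> u <= v -> v <= s -> f' u <= f' v) ->
  0 < m <= s -> all (fun x => 0 < x <= s) xs ->
  (size xs)%:R * f m + f' m * (\sum_(x <- xs) x - (size xs)%:R * m)
    <= \sum_(x <- xs) f x.
Proof.
move=> f'_homo ms; elim: xs => [|x xs IH] /=.
  by rewrite !big_nil !mul0r subrr mulr0 addr0.
move=> /andP[xs0 /IH {}IH]; rewrite !big_cons -natr1.
have := tangent_le f'_homo ms xs0.
by lra.
Qed.

Variable s : R.
Hypothesis s0 : 0 < s.
Hypothesis f'_homo : forall u v, 0 < u -> u <= v -> v <= s -> f' u <= f' v.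
Hypothesis f'_anti : forall u v, s <= u -> u <= v -> f' v <= f' u.

(** Beyond [s] the slopes decrease, so [f] gains more from [s] to [x] than over
    the interval of the same length starting at [y >= x]. *)
Lemma spread_le x y : s <= x -> s <= y -> f s + f (x + y - s) <= f x + f y.
Proof.
wlog xy : x y / x <= y => [hw|] sx sy.
  have [|/ltW] := leP x y => xy; first exact: hw.
  by rewrite (addrC x) (addrC (f x)); apply: hw.
have [c /andP[sc cx] fsx] := mvt_pos s0 sx.
have yxys : y <= x + y - s by lra.
have [e /andP[ye _] fy] := mvt_pos (lt_le_trans s0 sy) yxys.
have : f' e * (x - s) <= f' c * (x - s).
  by rewrite ler_wpM2r ?subr_ge0// f'_anti// (le_trans cx)// (le_trans xy).
by lra.
Qed.

(** Spreading pairs of entries above [s] until only [y] is left there.  The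
    induction carries the exceptional entry [y] along the list; whenever [y] and
    the new entry both exceed [s], one of them is lowered to [s] and the other
    takes the difference. *)
Lemma concentrate_le x0 (xs : seq R) : all (> 0) (x0 :: xs) ->
  exists y ys, [/\ 0 < y /\ size ys = size xs, all (fun z => 0 < z <= s) ys,
    y + \sum_(z <- ys) z = \sum_(x <- x0 :: xs) x
    & f y + \sum_(z <- ys) f z <= \sum_(x <- x0 :: xs) f x].
Proof.
elim: xs x0 => [|x1 xs IH] x0 /=.
  by rewrite andbT => x00; exists x0, [::]; rewrite !big_cons !big_nil; split.
move=> /and3P[x00 x10 xs0].
have [|y [ys [[y0 sz] ys0 sumE sum_le]]] := IH x0; first by rewrite /= x00.
move: sumE sum_le; rewrite !big_cons => sumE sum_le.
have [x1s|/ltW sx1] := leP x1 s.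
  exists y, (x1 :: ys); rewrite /= sz x10 x1s ys0 !big_cons.
  by split=> //; lra.
have [ys'|/ltW sy] := leP y s.
  exists x1, (y :: ys); rewrite /= sz y0 ys' ys0 !big_cons.
  by split=> //; lra.
exists (x1 + y - s), (s :: ys); rewrite /= sz s0 lexx ys0 !big_cons.
have := spread_le sx1 sy.
by split=> //; [split=> //|..]; lra.
Qed.

(** After concentration, all entries but one lie in the convex range, and
    Jensen's inequality replaces them by their average. *)
Lemma two_value_le x0 (xs : seq R) : xs != [::] -> all (> 0) (x0 :: xs) ->
  exists x y, [/\ 0 < x, 0 < y,
    y + (size xs)%:R * x = \sum_(z <- x0 :: xs) z
    & f y + (size xs)%:R * f x <= \sum_(z <- x0 :: xs) f z].
Proof.
move=> xsN0 /concentrate_le[y [ys [[y0 sz] ys0 <- sum_le]]].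
have n0 : (0 : R) < (size xs)%:R by rewrite ltr0n lt0n size_eq0.
pose x := (\sum_(z <- ys) z) / (size xs)%:R.
have xE : (size xs)%:R * x = \sum_(z <- ys) z.
  by rewrite mulrC divfK// gt_eqF.
have xs_ : 0 < x <= s.
  rewrite -(ltr_pM2l n0) -[_ <= s](ler_pM2l n0) xE mulr0 -sz.
  by apply: sum_itv => //; rewrite -size_eq0 sz size_eq0.
exists x, y; case/andP: (xs_) => x_gt0 _; split=> //; first by rewrite xE.
have := sum_tangent f'_homo xs_ ys0; rewrite sz xE subrr mulr0.
by lra.
Qed.

End HalfConvex.

(** * The gap function and its two-point sums *)

Section Gap.
Context (R : realType) (p : R).
Implicit Types (k c u v x y : R).

(** With [k = p/4 - a], the Beckner inequality with constant [a] for a list of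
    mean 1 says that [gap k] has a nonnegative sum over it. *)
Definition gap (k x : R) : R :=
  k * powR x p - p / 4 * powR x (p - 1) + (p / 4 - k).

Definition dgap (k x : R) : R :=
  k * (p * powR x (p - 1)) - p / 4 * ((p - 1) * powR x (p - 1 - 1)).

(** The factored form shows that the convexity of [gap k] is decided by the sign
    of an affine function of [x]. *)
Definition d2gap (k x : R) : R :=
  powR x (p - 1 - 1 - 1) * (p * (p - 1) * (k * x + (2 - p) / 4)).

Lemma is_derive_gap k (x : R) : 0 < x -> is_derive x 1 (gap k) (dgap k x).
Proof.
move=> x0; rewrite /gap.
have h1 := is_derive1_powR p x0; have h2 := is_derive1_powR (p - 1) x0.
(* Pointwise operations, which derivative inference recognizes. *)
have -> : (fun x => k * powR x p - p / 4 * powR x (p - 1) + (p / 4 - k)) =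
   (k \*: (fun y => powR y p)) - ((p / 4) \*: (fun y => powR y (p - 1)))
   + cst (p / 4 - k) by [].
apply: is_derive_eq; rewrite /dgap /GRing.scale/= addr0.
by [].
Qed.

Lemma is_derive_dgap k (x : R) : 0 < x -> is_derive x 1 (dgap k) (d2gap k x).
Proof.
move=> x0; rewrite /dgap.
have h1 := is_derive1_powR (p - 1) x0.
have h2 := is_derive1_powR (p - 1 - 1) x0.
have -> : (fun x => k * (p * powR x (p - 1)) -
    p / 4 * ((p - 1) * powR x (p - 1 - 1))) =
   ((k * p) \*: (fun y => powR y (p - 1)))
   - ((p / 4 * (p - 1)) \*: (fun y => powR y (p - 1 - 1))).
  by apply/funext => y; congr (_ - _); exact: mulrA.
apply: is_derive_eq; rewrite /d2gap /GRing.scale/=.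
have -> : powR x (p - 1 - 1) = powR x (p - 1 - 1 - 1) * x.
  rewrite -[X in _ * X](powRr1 (ltW x0)) -powRD ?subrK//.
  by rewrite (gt_eqF x0) implybT.
by ring.
Qed.

Lemma dgap_le k u v : 1 < p -> 0 < u -> u <= v ->
  (forall c, u <= c <= v -> 0 <= k * c + (2 - p) / 4) -> dgap k u <= dgap k v.
Proof.
move=> p1 u0 uv h; have [c ucv e] := mvt_pos (@is_derive_dgap k) u0 uv.
rewrite -subr_ge0 e mulr_ge0 ?subr_ge0// mulr_ge0 ?powR_ge0//.
by rewrite mulr_ge0 ?h// mulr_ge0//; lra.
Qed.

Lemma dgap_ge k u v : 1 < p -> 0 < u -> u <= v ->
  (forall c, u <= c <= v -> k * c + (2 - p) / 4 <= 0) -> dgap k v <= dgap k u.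
Proof.
move=> p1 u0 uv h; have [c ucv e] := mvt_pos (@is_derive_dgap k) u0 uv.
rewrite -subr_le0 e mulr_le0_ge0 ?subr_ge0// mulr_ge0_le0 ?powR_ge0//.
by rewrite mulr_ge0_le0 ?h// mulr_ge0//; lra.
Qed.

Lemma gap1 k : gap k 1 = 0.
Proof. by rewrite /gap !powR1; lra. Qed.

(** Strictness is obtained from the non-strict tangent inequality by going
    through the midpoint [w] of 1 and [x]: the tangents at 1 and at [w] have
    different slopes. *)
Lemma powR_gt_tangent x : 1 < p -> 0 <= x -> x != 1 ->
  1 + p * (x - 1) < powR x p.
Proof.
move=> p1 x0 x1.
have [w wE w0] : exists2 w, w = (1 + x) / 2 & 0 < w.
  by exists ((1 + x) / 2); lra.
(* The tangent line at w, rescaled from the tangent line at 1. *)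
have xw : powR w p + p * powR w (p - 1) * (x - w) <= powR x p.
  have := powR_tangent p1 (divr_ge0 x0 (ltW w0)).
  rewrite -(ler_pM2l (powR_gt0 p w0)) -powRM ?divr_ge0 ?(ltW w0)//.
  rewrite [w * _]mulrC divfK ?gt_eqF// => /(le_trans _); apply.
  rewrite -(@mulr_powRB1 _ w p) ?(ltW w0)//; last by lra.
  rewrite le_eqVlt; apply/orP; left; apply/eqP; field; exact: lt0r_neq0.
have ww := powR_tangent p1 (ltW w0).
have : 0 < (x - 1) * (powR w (p - 1) - 1).
  have [x1'|x1'|/eqP] := ltgtP x 1; last by rewrite (negPf x1).
    have : powR w (p - 1) < powR 1 (p - 1).
      by apply: gt0_ltr_powR; rewrite ?nnegrE; lra.
    by rewrite powR1; nra.
  have : powR 1 (p - 1) < powR w (p - 1).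
    by apply: gt0_ltr_powR; rewrite ?nnegrE; lra.
  by rewrite powR1; nra.
by rewrite {}wE in xw ww *; nra.
Qed.

(** The denominator of [twopt_ratio] is positive, so that comparing a constant
    with the ratio amounts to comparing products. *)
Lemma twopt_moment_gt1 t x y : 1 < p -> 0 < t < 1 -> 0 <= x -> 0 <= y ->
  t * x + (1 - t) * y = 1 -> (x, y) <> (1, 1) ->
  1 < t * powR x p + (1 - t) * powR y p.
Proof.
move=> p1 /andP[t0 t1] x0 y0 e xy.
have x1 : x != 1.
  apply/eqP => x1; apply: xy; congr (_, _) => //.
  by rewrite x1 in e; nra.
have h1 := powR_gt_tangent p1 x0 x1.
have h2 := powR_tangent p1 y0.
by nra.
Qed.

Lemma frac_itv (d n : nat) : (0 < n < d)%N -> 0 < (n%:R / d%:R : R) < 1.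
Proof.
move=> /andP[n0 nd]; have d0 : (0 : R) < d%:R by rewrite ltr0n (ltn_trans n0).
by rewrite ltr_pdivrMr// mul1r ltr_nat nd divr_gt0// ltr0n.
Qed.

Section LowerBound.
Variables (d : nat) (a : R).
Hypotheses (d1 : (1 < d)%N) (aP : forall r, twopt_values d p r -> a <= r).
Let k := p / 4 - a.

Lemma twopt_gap_ge0 n x y (t := n%:R / d%:R) : 1 < p -> (0 < n < d)%N ->
  0 <= x -> 0 <= y -> t * x + (1 - t) * y = 1 ->
  0 <= t * gap k x + (1 - t) * gap k y.
Proof.
move=> p1 nd x0 y0 e; have [[-> ->]|/eqP xy] := eqVneq (x, y) (1, 1).
  by rewrite gap1 !mulr0 addr0.
have M1 := twopt_moment_gt1 p1 (frac_itv nd) x0 y0 e xy.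
have : a <= twopt_ratio p t x y by apply: aP; exists n, x, y.
rewrite /twopt_ratio mulrA ler_pdivlMr ?subr_gt0// /gap /k -/t.
by lra.
Qed.

(** For [p = 2] the moment of order [p - 1] is the mean, which is 1, so numerator
    and denominator of the ratio agree. *)
Lemma twopt_lbound_le_half : 1 < p -> p = 2 -> a <= 1 / 2.
Proof.
move=> p1 pE; have d0 : (0 : R) < d%:R by rewrite ltr0n (ltn_trans _ d1).
have nd : (0 < 1 < d)%N by [].
have /andP[t0 t1] := frac_itv nd; set t := _ / _ in t0 t1.
pose y := (1 - t)^-1.
have y0 : 0 <= y by rewrite invr_ge0; lra.
have e : t * 0 + (1 - t) * y = 1.
  by rewrite mulr0 add0r divff// gt_eqF// subr_gt0.
have xy : ((0 : R), y) <> (1, 1).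
  by apply/eqP; rewrite xpair_eqE (lt_eqF ltr01).
have M1 := twopt_moment_gt1 p1 (frac_itv nd) (lexx 0) y0 e xy.
have : a <= twopt_ratio p t 0 y by apply: aP; exists 1%N, 0, y.
rewrite /twopt_ratio.
have -> : p - 1 = 1 by lra.
rewrite (powRr1 y0) (powRr1 (lexx 0)) e divff; last by rewrite gt_eqF ?subr_gt0.
by lra.
Qed.

Lemma sum_gap_ge0 (xs : seq R) : 1 < p -> p <= 2 ->
  size xs = d -> all (> 0) xs ->
  \sum_(x <- xs) x = d%:R -> 0 <= \sum_(x <- xs) gap k x.
Proof.
move=> p1 p2 xsd xs0 sumE.
have d0 : (0 : R) < d%:R by rewrite ltr0n (ltn_trans _ d1).
have [k0|k0] := leP 0 k.
  (* Convex everywhere: tangent line at 1, with all entries bounded by the sum d. *)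
  have homo u v : 0 < u -> u <= v -> v <= d%:R -> dgap k u <= dgap k v.
    move=> u0 uv _; apply: dgap_le => // c /andP[uc _].
    by have := mulr_ge0 k0 (ltW (lt_le_trans u0 uc)); lra.
  have m01 : 0 < (1 : R) <= d%:R by rewrite ltr01 ler1n (ltn_trans _ d1).
  have xsd' : all (fun x => 0 < x <= d%:R) xs.
    apply/allP => x xxs; rewrite (allP xs0)//= -sumE (big_rem x)//= lerDl.
    rewrite big_seq sumr_ge0// => y /mem_rem yxs.
    by rewrite ltW// (allP xs0).
  have := sum_tangent (@is_derive_gap k) homo m01 xsd'.
  by rewrite gap1 mulr0 add0r mulr1 sumE xsd subrr mulr0.
have p2' : p < 2.
  rewrite lt_neqAle p2 andbT; apply/eqP => pE.
  by have := twopt_lbound_le_half p1 pE; move: k0; rewrite /k; lra.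
(* The inflection point of the gap function. *)
pose s := (2 - p) / (4 * - k).
have s0 : 0 < s by rewrite divr_gt0//; lra.
have ks : k * s = - ((2 - p) / 4) by rewrite /s; field; lra.
have homo u v : 0 < u -> u <= v -> v <= s -> dgap k u <= dgap k v.
  move=> u0 uv vs; apply: dgap_le => // c /andP[_ cv].
  have : 0 <= - k * (s - c) by rewrite mulr_ge0; lra.
  by lra.
have anti u v : s <= u -> u <= v -> dgap k v <= dgap k u.
  move=> su uv; apply: dgap_ge => //; first exact: lt_le_trans su.
  move=> c /andP[uc _].
  have : 0 <= - k * (c - s) by rewrite mulr_ge0; lra.
  by lra.
case: xs xsd xs0 sumE => [|x0 xs] xsd xs0 sumE.
  by rewrite big_nil.
have xsN0 : xs != [::].
  by rewrite -size_eq0; have := d1; rewrite -xsd; case: (xs).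
have [x [y [x_gt0 y_gt0 xyE xy_le]]] :=
  two_value_le (@is_derive_gap k) s0 homo anti xsN0 xs0.
apply: le_trans xy_le; move: xyE; rewrite sumE.
have -> : size xs = d.-1 by rewrite -xsd.
have dE : d%:R = 1 + d.-1%:R :> R by rewrite nat1r prednK// (ltn_trans _ d1).
have nd : (0 < d.-1 < d)%N.
  rewrite prednK ?(ltn_trans _ d1)// leqnn andbT.
  by rewrite -ltnS prednK// (ltn_trans _ d1).
(* The averaged value x has weight (d - 1) / d, the isolated value y has 1 / d. *)
have := @twopt_gap_ge0 _ x y p1 nd (ltW x_gt0) (ltW y_gt0).
have d0' : d%:R != 0 :> R by rewrite gt_eqF.
have -> : 1 - d.-1%:R / d%:R = d%:R^-1 :> R by rewrite dE; field; rewrite -dE.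
move=> h xyE; have /h : d.-1%:R / d%:R * x + d%:R^-1 * y = 1.
  by rewrite mulrAC [_^-1 * y]mulrC -mulrDl addrC xyE divff.
have -> : d.-1%:R / d%:R * gap k x + d%:R^-1 * gap k y =
    d%:R^-1 * (gap k y + d.-1%:R * gap k x) by ring.
by rewrite pmulr_rge0// invr_gt0.
Qed.

End LowerBound.

End Gap.

(** * The Beckner inequality for lists of positive numbers *)

Section Scalar.
Context (R : realType).
Implicit Types (p a r x y : R) (xs : seq R) (d : nat).

Definition mean xs : R := (\sum_(x <- xs) x) / (size xs)%:R.

Definition pmean r xs : R := mean [seq powR x r | x <- xs].

(** The Beckner inequality in terms of eigenvalues, after division by the
    conjugate exponent. *)
Definition scalar_beckner p a xs : bool :=
  a * (pmean p xs - powR (mean xs) p)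
    <= p / 4 * (pmean p xs - mean xs * pmean (p - 1) xs).

Lemma pmeanE r xs : pmean r xs = (\sum_(x <- xs) powR x r) / (size xs)%:R.
Proof. by rewrite /pmean /mean big_map size_map. Qed.

Lemma mean_gt0 xs : xs != [::] -> all (> 0) xs -> 0 < mean xs.
Proof.
move=> xs0 xs_gt0; rewrite divr_gt0 ?ltr0n ?lt0n ?size_eq0//.
case: xs xs0 xs_gt0 => // x xs _ /= /andP[x0 /allP xs0].
rewrite big_cons ltr_pwDl// big_seq sumr_ge0// => y yxs.
exact/ltW/xs0.
Qed.

Lemma pmean_ge0 r xs : 0 <= pmean r xs.
Proof.
by rewrite pmeanE divr_ge0// sumr_ge0// => x _; exact: powR_ge0.
Qed.

Lemma pmean1 xs : all (> 0) xs -> pmean 1 xs = mean xs.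
Proof.
move=> /allP xs0; rewrite pmeanE /mean; congr (_ / _).
rewrite big_seq [RHS]big_seq; apply: eq_bigr => x /xs0/ltW.
exact: powRr1.
Qed.

Lemma mean_perm xs ys : perm_eq xs ys -> mean xs = mean ys.
Proof. by move=> h; rewrite /mean (perm_big _ h) (perm_size h). Qed.

Lemma scalar_beckner_perm p a xs ys :
  perm_eq xs ys -> scalar_beckner p a xs = scalar_beckner p a ys.
Proof.
move=> h; have pE r : pmean r xs = pmean r ys by exact/mean_perm/perm_map.
by rewrite /scalar_beckner !pE (mean_perm h).
Qed.

Lemma mean_two_value d n x y (t := n%:R / d%:R)
    (xs := nseq n x ++ nseq (d - n) y) :
  (0 < n < d)%N -> mean xs = t * x + (1 - t) * y.
Proof.
move=> /andP[n0 nd]; have d0 : d%:R != 0 :> R.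
  by rewrite pnatr_eq0 -lt0n (ltn_trans n0).
rewrite /mean /xs size_cat !size_nseq subnKC ?(ltnW nd)//.
rewrite big_cat/= !big_nseq !iter_addr_0 -(mulr_natl x) -(mulr_natl y).
rewrite natrB ?(ltnW nd)// /t.
by field.
Qed.

(** Both sides are homogeneous of degree [p], so dividing the list by its mean
    reduces to [sum_gap_ge0]. *)
Lemma scalar_beckner_of_twopt d p a xs : (1 < d)%N -> 1 < p -> p <= 2 ->
  (forall r, twopt_values d p r -> a <= r) ->
  size xs = d -> all (> 0) xs -> scalar_beckner p a xs.
Proof.
move=> d1 p1 p2 aP xsd xs0.
have d0 : (0 : R) < d%:R by rewrite ltr0n (ltn_trans _ d1).
have m0 : 0 < mean xs.
  by apply: mean_gt0 => //; rewrite -size_eq0 xsd -lt0n (ltn_trans _ d1).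
pose ys := [seq x / mean xs | x <- xs].
have ysd : size ys = d by rewrite size_map.
have ys0 : all (> 0) ys.
  by apply/allP => _ /mapP[x xxs ->]; rewrite divr_gt0// (allP xs0).
have sumE : \sum_(y <- ys) y = d%:R.
  rewrite big_map -mulr_suml /mean xsd invf_div mulrC divfK// gt_eqF//.
  by move: m0; rewrite /mean xsd pmulr_lgt0// invr_gt0.
have := sum_gap_ge0 d1 aP p1 p2 ysd ys0 sumE.
(* Multiplying by (mean xs)^p / d undoes the normalization. *)
have powE r : \sum_(y <- ys) powR y r =
    (\sum_(x <- xs) powR x r) / powR (mean xs) r.
  rewrite big_map mulr_suml big_seq [RHS]big_seq.
  apply: eq_bigr => x /(allP xs0)/ltW x0.
  rewrite -{2}[x](divfK (lt0r_neq0 m0)).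
  rewrite (powRM r (divr_ge0 x0 (ltW m0)) (ltW m0)).
  by rewrite mulfK// gt_eqF// powR_gt0.
have aE : p / 4 - (p / 4 - a) = a by ring.
rewrite /gap aE !big_split/= sumrN -!mulr_sumr !powE.
rewrite big_const_seq count_predT iter_addr_0 ysd /scalar_beckner !pmeanE xsd.
set m := mean xs in m0 *; set q := powR m (p - 1).
have q0 : 0 < q by exact: powR_gt0.
have -> : powR m p = m * q by rewrite mulr_powRB1 ?(ltW m0)//; lra.
move: (\sum_(x <- xs) powR x p) (\sum_(x <- xs) powR x (p - 1)) => Sp Sq gap0.
have := mulr_ge0 (divr_ge0 (mulr_ge0 (ltW m0) (ltW q0)) (ltW d0)) gap0.
set A := (X in 0 <= X -> _).
suff -> : A = p / 4 * (Sp / d%:R - m * (Sq / d%:R)) - a * (Sp / d%:R - m * q).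
  by rewrite subr_ge0.
rewrite /A -mulr_natl; field.
by rewrite !gt_eqF.
Qed.

(** The powers are continuous up to the boundary point 0 along the segment that
    joins [x] to 1. *)
Lemma powR_segment_cvg r x : 0 < r -> 0 <= x ->
  (powR (x + t * (1 - x)) r) @[t --> 0^'+] --> powR x r.
Proof.
move=> r0; rewrite le_eqVlt => /predU1P[<-|x0].
  rewrite powR0 ?gt_eqF//; under eq_fun do rewrite add0r subr0 mulr1.
  exact: powR_cvg0.
have px : {for x, continuous (fun z : R => powR z r)}.
  apply/differentiable_continuous/derivable1_diffP/derivable_powR.
  by rewrite in_itv/= x0.
apply: (continuous_cvg _ px).
have xE : x + 0 * (1 - x) = x by rewrite mul0r addr0.
rewrite -[X in _ --> X]xE.
apply: cvgD; first exact: cvg_cst.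
apply: cvgM; last exact: cvg_cst.
by apply: cvg_within_filter; exact: cvg_id.
Qed.

(** The points [(z x v, z y v)] for [0 < v < 1] lie on the segment from [(x, y)]
    to [(1, 1)]: they are positive and keep the weighted mean 1, so they come from
    lists with two values, and [v] tends to 0. *)
Lemma scalar_beckner_le_twopt d p a r : 1 < p ->
  (forall xs, size xs = d -> all (> 0) xs -> scalar_beckner p a xs) ->
  twopt_values d p r -> a <= r.
Proof.
move=> p1 bx [n [x [y [nd [x0 y0] e xy ->]]]].
have /andP[_ ltnd] := nd.
have t01 := frac_itv R nd.
set t := _ / _ in e t01 *.
have M1 := twopt_moment_gt1 p1 t01 x0 y0 e xy.
rewrite /twopt_ratio mulrA ler_pdivlMr ?subr_gt0//.
pose z (u v : R) := u + v * (1 - u).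
pose M (s : R) (v : R) := t * powR (z x v) s + (1 - t) * powR (z y v) s.
have Mcvg s : 0 < s ->
    M s v @[v --> 0^'+] --> t * powR x s + (1 - t) * powR y s.
  move=> s0; apply: cvgD; apply: cvgM; try exact: cvg_cst;
    exact: powR_segment_cvg.
rewrite -subr_ge0.
have : (p / 4 * (M p v - M (p - 1) v) - a * (M p v - 1)) @[v --> 0^'+] -->
    p / 4 * (t * powR x p + (1 - t) * powR y p
             - (t * powR x (p - 1) + (1 - t) * powR y (p - 1)))
    - a * (t * powR x p + (1 - t) * powR y p - 1).
  have hp : 0 < p by lra.
  have hq : 0 < p - 1 by lra.
  apply: cvgB; apply: cvgM; try exact: cvg_cst.
    apply: cvgB; exact: Mcvg.
  apply: cvgB; [exact: Mcvg|exact: cvg_cst].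
move=> /cvgr_to_ge; apply.
near=> v.
have v0 : 0 < v by [].
have v1 : v < 1 by near: v; exact: nbhs_right_lt.
have zp u : 0 <= u -> 0 < z u v by rewrite /z => u0; nra.
pose xs := nseq n (z x v) ++ nseq (d - n) (z y v).
have xsd : size xs = d by rewrite size_cat !size_nseq subnKC// ltnW.
have xs0 : all (> 0) xs by rewrite all_cat !all_nseq !zp// !orbT.
have := bx _ xsd xs0; rewrite /scalar_beckner.
have pE s : pmean s xs = M s v.
  by rewrite /pmean map_cat !map_nseq mean_two_value.
have mE : mean xs = 1.
  rewrite mean_two_value// -/t.
  have -> : t * z x v + (1 - t) * z y v = (1 - v) * (t * x + (1 - t) * y) + v.
    by rewrite /z; ring.
  by rewrite e; ring.
by rewrite !pE mE powR1 mul1r -subr_ge0.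
Unshelve. all: by end_near.
Qed.

End Scalar.

(** * From matrices to their spectra *)

Lemma char_poly_conj (F : fieldType) (n : nat) (P A : 'M[F]_n) :
  P \in unitmx -> char_poly (invmx P *m A *m P) = char_poly A.
Proof.
move=> Pu; rewrite /char_poly.
have -> : char_poly_mx (invmx P *m A *m P) =
    map_mx polyC (invmx P) *m char_poly_mx A *m map_mx polyC P.
  rewrite /char_poly_mx mulmxBr mulmxBl !map_mxM; congr (_ - _).
  by rewrite mul_mx_scalar -scalemxAl -map_mxM mulVmx// map_mx1 scalemx1.
by rewrite !det_mulmx mulrAC -det_mulmx -map_mxM mulVmx// map_mx1 det1 mul1r.
Qed.

(** The characteristic polynomial is invariant under conjugation and its roots are
    the diagonal entries with their multiplicities. *)
Lemma perm_diag_conj (F : fieldType) (n : nat) (P : 'M[F]_n) (u v : 'rV[F]_n) :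
  P \in unitmx -> diag_mx u = invmx P *m diag_mx v *m P ->
  perm_eq [seq u 0 i | i : 'I_n] [seq v 0 i | i : 'I_n].
Proof.
move=> Pu e; apply: prod_XsubC_eq; rewrite !big_image/=.
have diagE (w : 'rV[F]_n) :
    char_poly (diag_mx w) = \prod_(i < n) ('X - (w 0 i)%:P).
  rewrite char_poly_trig ?diag_mx_is_trig//.
  by apply: eq_bigr => i _; rewrite mxE eqxx.
by rewrite -!diagE e char_poly_conj.
Qed.

Section Spectrum.
Context (R : realType) (d : nat).
Implicit Types (X Y : 'M[R[i]]_d) (xs : seq R) (p a r : R).

Definition spectrum X : seq R :=
  [seq complex.Re (spectral_diag X 0 i) | i : 'I_d].

Lemma size_spectrum X : size (spectrum X) = d.
Proof. by rewrite size_map -cardE card_ord. Qed.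

Lemma posdefmxE X : posdefmx X ->
  X = invmx (spectralmx X) *m diag_mx (spectral_diag X) *m spectralmx X.
Proof. by case=> /hermitian_normalmx /orthomx_spectralP. Qed.

(** An eigenvalue is the value of the quadratic form at the corresponding row of
    the unitary matrix [spectralmx X]. *)
Lemma posdefmx_spectral_diag_gt0 X (i : 'I_d) :
  posdefmx X -> 0 < spectral_diag X 0 i.
Proof.
move=> Xpos; have XE := posdefmxE Xpos; case: Xpos => _ Xpos.
have Pu := spectral_unit X.
set e := delta_mx 0 i : 'rV[R[i]]_d.
have e0 : e != 0.
  apply/eqP => /matrixP /(_ 0 i) /eqP.
  by rewrite !mxE !eqxx oner_eq0.
have v0 : e *m spectralmx X != 0.
  by apply: contra e0 => /eqP v0; rewrite -(mulmxK Pu e) v0 mul0mx.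
have := Xpos _ v0; rewrite trmx_mul map_mxM.
rewrite -(invmx_unitary (spectral_unitarymx X)) {2}XE !mulmxA !(mulmxK Pu).
set z := (X in 0 < X -> _); suff -> : z = spectral_diag X 0 i by []; rewrite /z.
rewrite -rowE mxE (bigD1 i)//= big1 ?addr0 => [|j ji].
  by rewrite !mxE !eqxx mulr1n rmorph1 mulr1.
by rewrite !mxE eq_sym (negPf ji) mulr0n mul0r.
Qed.

Lemma spectral_diagE X (i : 'I_d) : posdefmx X ->
  spectral_diag X 0 i = (complex.Re (spectral_diag X 0 i))%:C.
Proof.
move=> /(posdefmx_spectral_diag_gt0 i).
by case: (spectral_diag X 0 i) => x y; rewrite ltcE/= => /andP[/eqP-> _].
Qed.

Lemma spectrum_gt0 X x : posdefmx X -> x \in spectrum X -> 0 < x.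
Proof.
move=> Xpos /mapP[i _ ->].
by have := posdefmx_spectral_diag_gt0 i Xpos; rewrite ltcE => /andP[].
Qed.

Lemma ntrace_spectral_conj X (u : 'rV[R[i]]_d) :
  ntrace (invmx (spectralmx X) *m diag_mx u *m spectralmx X)
    = (\sum_i complex.Re (u 0 i)) / d%:R.
Proof.
rewrite /ntrace mxtrace_mulC mulmxA mulmxV ?spectral_unit// mul1mx.
by rewrite mxtrace_diag raddf_sum.
Qed.

Lemma ntrace_mxpow X r : ntrace (mxpow X r) = pmean r (spectrum X).
Proof.
rewrite /mxpow ntrace_spectral_conj pmeanE size_spectrum big_image/=.
by under eq_bigr do rewrite mxE/=.
Qed.

Lemma ntrace_mean X : posdefmx X -> ntrace X = mean (spectrum X).
Proof.
move=> Xpos; rewrite /mean size_spectrum {1}(posdefmxE Xpos).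
by rewrite ntrace_spectral_conj big_image.
Qed.

Lemma ntrace_mxpowM X r : 0 < r -> posdefmx X ->
  ntrace (mxpow X (r - 1) *m X) = pmean r (spectrum X).
Proof.
move=> r0 Xpos; rewrite {2}(posdefmxE Xpos) /mxpow !mulmxA.
rewrite mulmxK ?spectral_unit// -(mulmxA (invmx _)) mulmx_diag.
rewrite ntrace_spectral_conj pmeanE size_spectrum big_image/=.
congr (_ / _); apply: eq_bigr => i _.
rewrite !mxE (spectral_diagE i Xpos) -rmorphM/= mulrC mulr_powRB1//.
by apply/ltW/(spectrum_gt0 Xpos)/map_f; rewrite mem_enum.
Qed.

Lemma posdefmx_diag xs (u := \row_(i < d) (nth 0 xs i)%:C) : size xs = d ->
  all (> 0) xs -> posdefmx (diag_mx u).
Proof.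
move=> xsd /allP xs0.
have xi0 (i : 'I_d) : 0 < nth 0 xs i by apply/xs0/mem_nth; rewrite xsd.
split.
  rewrite is_hermitianmxE expr0 scale1r tr_diag_mx map_diag_mx.
  apply/eqP; congr diag_mx; apply/rowP => i.
  by rewrite !mxE; apply/esym/conj_Creal; rewrite realE lecR ltW.
move=> v v0; have [i vi] : exists i, v 0 i != 0.
  apply/existsP; apply: contraR v0 => /existsPn v0.
  by apply/eqP/rowP => i; rewrite mxE; apply/eqP; have := v0 i; rewrite negbK.
have vv j : (v *m diag_mx u) 0 j * (v ^t*) j 0 =
    (nth 0 xs j)%:C * `|v 0 j| ^+ 2.
  by rewrite mul_mx_diag !mxE mulrAC -normCK mulrC.
rewrite mxE; under eq_bigr do rewrite vv.
rewrite (bigD1 i)//= ltr_pwDl//.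
  by rewrite mulr_gt0 ?ltcR// exprn_gt0// normr_gt0.
apply: sumr_ge0 => j _; rewrite mulr_ge0 ?exprn_ge0//.
by rewrite lecR ltW.
Qed.

(** Every list of positive numbers is a spectrum, up to the order that the chosen
    diagonalization imposes. *)
Lemma perm_spectrum_diag xs (u := \row_(i < d) (nth 0 xs i)%:C) : size xs = d ->
  all (> 0) xs -> perm_eq (spectrum (diag_mx u)) xs.
Proof.
move=> xsd xs0; have Xpos := posdefmx_diag xsd xs0.
have := posdefmxE Xpos => /perm_diag_conj -/(_ (spectral_unit _)).
move=> /(perm_map (@complex.Re R)).
rewrite perm_sym -!(map_comp (@complex.Re R)) => h.
apply: (perm_trans h) => {h}.
rewrite (_ : [seq _ | i <- _] = xs)//.
apply: (@eq_from_nth _ 0); rewrite size_map -cardE card_ord// => i id.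
by rewrite (nth_map (Ordinal id)) -?cardE ?card_ord//= mxE nth_enum_ord.
Qed.

Lemma powR_mxpnorm p X : p != 0 ->
  powR (mxpnorm p X) p = pmean p (spectrum X).
Proof.
move=> p0; rewrite /mxpnorm ntrace_mxpow -powRrM mulVf//.
exact/powRr1/pmean_ge0.
Qed.

Lemma mxpnorm1 X : posdefmx X ->
  mxpnorm 1 X = mean (spectrum X).
Proof.
move=> Xpos; rewrite /mxpnorm ntrace_mxpow invr1 powRr1 ?pmean_ge0//.
by apply: pmean1; apply/allP => x; exact: spectrum_gt0.
Qed.

Lemma ntraceB X Y : ntrace (X - Y) = ntrace X - ntrace Y.
Proof. by rewrite /ntrace !raddfB/= mulrBl. Qed.

Lemma ntraceZ (c : R) X : ntrace (c%:C *: X) = c * ntrace X.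
Proof.
rewrite /ntrace mxtraceZ mulrA; congr (_ / _).
by case: (\tr X) => u v /=; rewrite mul0r subr0.
Qed.

(** The complex trace in [depol] is real, because the eigenvalues are. *)
Lemma depol_mean X : posdefmx X ->
  depol X = ((mean (spectrum X))%:C)%:M - X.
Proof.
move=> Xpos; rewrite /depol; congr (_%:M - _).
have trE : \tr X = (complex.Re (\tr X))%:C.
  rewrite {1 2}(posdefmxE Xpos) mxtrace_mulC mulmxA.
  rewrite mulmxV ?spectral_unit// mul1mx.
  rewrite mxtrace_diag raddf_sum rmorph_sum; apply: eq_bigr => i _.
  exact: spectral_diagE.
rewrite mxtraceZ trE -ntrace_mean// /ntrace mulrC rmorphM fmorphV.
by rewrite rmorph_nat.
Qed.

Lemma pdirichlet_depolE p X : 1 < p -> posdefmx X ->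
  pdirichlet (@depol R d) p X = hconj p * (p / 4 *
    (pmean p (spectrum X) - mean (spectrum X) * pmean (p - 1) (spectrum X))).
Proof.
move=> p1 Xpos; rewrite /pdirichlet depol_mean// mulmxBr mul_mx_scalar.
rewrite ntraceB ntraceZ ntrace_mxpow ntrace_mxpowM//; last by lra.
by rewrite !mulrA mulNr -mulrN opprB.
Qed.

Lemma beckner_depol_spectrum p a X : 1 < p -> posdefmx X ->
  (a * hconj p * (powR (mxpnorm p X) p - powR (mxpnorm 1 X) p)
     <= pdirichlet (@depol R d) p X) = scalar_beckner p a (spectrum X).
Proof.
move=> p1 Xpos; have q0 : 0 < hconj p by rewrite /hconj divr_gt0//; lra.
have pN0 : p != 0 by rewrite gt_eqF// (lt_trans _ p1).
rewrite mxpnorm1// (powR_mxpnorm X pN0) pdirichlet_depolE//.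
by rewrite -mulrA mulrCA ler_pM2l.
Qed.

Lemma beckner_ineq_depolE p a : 1 < p ->
  beckner_ineq (@depol R d) p a <->
  forall xs, size xs = d -> all (> 0) xs -> scalar_beckner p a xs.
Proof.
move=> p1; split=> [bX xs xsd xs0|bx X Xpos].
  have Xpos := posdefmx_diag xsd xs0; have := bX _ Xpos.
  rewrite beckner_depol_spectrum//.
  by rewrite (scalar_beckner_perm _ _ (perm_spectrum_diag xsd xs0)).
rewrite beckner_depol_spectrum//; apply: bx; first exact: size_spectrum.
by apply/allP => x; exact: spectrum_gt0.
Qed.

End Spectrum.

Unset Implicit Arguments.

Theorem proposition3p29 (R : realType) (d : nat) (hd : (2 <= d)%N)
    (p : R) (hp1 : 1 < p) (hp2 : p <= 2) :
  optimal_beckner (@depol R d) p (inf (twopt_values d p)).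
Proof.
have [inf0 inflb] := has_inf_twopt_values (R := R) hd hp1.
split.
  apply/beckner_ineq_depolE => // xs.
  by apply: scalar_beckner_of_twopt => // r; exact: ge_inf.
move=> b /(beckner_ineq_depolE _ _ hp1) bx; apply: lb_le_inf => // r.
exact: scalar_beckner_le_twopt.
Qed.
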